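(* In the setting described in the context, assume there exists $\bar Z\in\mathbb{R}^{(n+m)\times n}$ with $\begin{bmatrix} I\\ \bar Z\end{bmatrix}^\top N\begin{bmatrix} I\\ \bar Z\end{bmatrix}>0$. Then the data $(U_-,X)$ are informative for quadratic stabilization if and only if there exist a symmetric $P\in\mathbb{R}^{n\times n}$ with $P>0$, a matrix $L\in\mathbb{R}^{m\times n}$ and scalars $\alpha\ge0$, $\beta>0$ such that $$\begin{bmatrix} P-\beta I & 0 & 0 & 0\\ 0 & -P & -L^\top & 0\\ 0 & -L & 0 & L\\ 0 & 0 & L^\top & P\end{bmatrix}-\alpha\begin{bmatrix} I & X_+\\ 0 & -X_-\\ 0 & -U_-\\ 0 & 0\end{bmatrix}\begin{bmatrix}\Phi_{11} & \Phi_{12}\\ \Phi_{12}^\top & \Phi_{22}\end{bmatrix}\begin{bmatrix} I & X_+\\ 0 & -X_-\\ 0 & -U_-\\ 0 & 0\end{bmatrix}^\top\ge 0$$ (block rows/columns of sizes $n,n,m,n$). Moreover, if $P,L$ (together with some $\alpha\ge0,\beta>0$) satisfy this inequality, then $K:=LP^{-1}$ satisfies $P-(A+BK)P(A+BK)^\top>0$ for all $(A,B)\in\Sigma$; in particular $A+BK$ is Schur stable for all $(A,B)\in\Sigma$.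
   Context: Consider the system $x(t+1)=A_sx(t)+B_su(t)+w(t)$ with unknown $A_s\in\mathbb{R}^{n\times n}$, $B_s\in\mathbb{R}^{n\times m}$ and unknown noise $w$. Data: $X_+=[x(1)\ \cdots\ x(T)]$, $X_-=[x(0)\ \cdots\ x(T-1)]$, $U_-=[u(0)\ \cdots\ u(T-1)]$, with $X_+=A_sX_-+B_sU_-+W_-$ where $W_-=[w(0)\ \cdots\ w(T-1)]$ satisfies $\begin{bmatrix} I\\ W_-^\top\end{bmatrix}^\top\begin{bmatrix}\Phi_{11} & \Phi_{12}\\ \Phi_{12}^\top & \Phi_{22}\end{bmatrix}\begin{bmatrix} I\\ W_-^\top\end{bmatrix}\ge0$ for known $\Phi_{11}=\Phi_{11}^\top\in\mathbb{R}^{n\times n}$, $\Phi_{12}\in\mathbb{R}^{n\times T}$, $\Phi_{22}=\Phi_{22}^\top\in\mathbb{R}^{T\times T}$, $\Phi_{22}<0$. $\Sigma$ is the set of all $(A,B)$ such that $X_+=AX_-+BU_-+W$ for some $W\in\mathbb{R}^{n\times T}$ satisfying the same noise inequality. Define the symmetric matrix $N:=\begin{bmatrix} I & X_+\\ 0 & -X_-\\ 0 & -U_-\end{bmatrix}\begin{bmatrix}\Phi_{11} & \Phi_{12}\\ \Phi_{12}^\top & \Phi_{22}\end{bmatrix}\begin{bmatrix} I & X_+\\ 0 & -X_-\\ 0 & -U_-\end{bmatrix}^\top\in\mathbb{R}^{(2n+m)\times(2n+m)}$, where in $\begin{bmatrix} I\\ \bar Z\end{bmatrix}$ the identity is $n\times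 n$. The data $(U_-,X)$ are called informative for quadratic stabilization if there exist $K\in\mathbb{R}^{m\times n}$ and symmetric $P>0$ with $P-(A+BK)P(A+BK)^\top>0$ for all $(A,B)\in\Sigma$. *)

(* Defs.v *)
From HB Require Import structures.
From mathcomp Require Import all_boot all_order all_algebra.
From mathcomp Require Import reals.
From mathcomp.real_closed Require Import complex.
Set Implicit Arguments. Unset Strict Implicit. Unset Printing Implicit Defensive.
Import Order.TTheory GRing.Theory Num.Theory.
Local Open Scope ring_scope.

Section Defs.
Variable R : realType.

Definition symmx n (M : 'M[R]_n) := M^T = M.

Definition posdef n (M : 'M[R]_n) :=
  symmx M /\ forall v : 'cV[R]_n, v != 0 -> 0 < (v^T *m M *m v) 0 0.

Definition possemidef n (M : 'M[R]_n) :=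
  symmx M /\ forall v : 'cV[R]_n, 0 <= (v^T *m M *m v) 0 0.

Definition negdef n (M : 'M[R]_n) := posdef (- M).

Definition schur_stable n (M : 'M[R]_n) :=
  forall lam : R[i], eigenvalue (map_mx (fun x : R => (x%:C)%C) M) lam -> `|lam| < 1.

Definition Phi n T (Phi11 : 'M[R]_n) (Phi12 : 'M[R]_(n, T)) (Phi22 : 'M[R]_T)
  : 'M[R]_(n + T) := block_mx Phi11 Phi12 Phi12^T Phi22.

Definition noise_ok n T (Phi11 : 'M[R]_n) (Phi12 : 'M[R]_(n, T)) (Phi22 : 'M[R]_T)
  (W : 'M[R]_(n, T)) :=
  possemidef ((col_mx 1%:M W^T)^T *m Phi Phi11 Phi12 Phi22 *m col_mx 1%:M W^T).

Definition Sigma n m T (Xp Xm : 'M[R]_(n, T)) (Um : 'M[R]_(m, T))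
  (Phi11 : 'M[R]_n) (Phi12 : 'M[R]_(n, T)) (Phi22 : 'M[R]_T)
  (A : 'M[R]_n) (B : 'M[R]_(n, m)) :=
  exists W : 'M[R]_(n, T), Xp = A *m Xm + B *m Um + W /\ noise_ok Phi11 Phi12 Phi22 W.

Definition Nfac n m T (Xp Xm : 'M[R]_(n, T)) (Um : 'M[R]_(m, T))
  : 'M[R]_(n + (n + m), n + T) :=
  col_mx (row_mx 1%:M Xp) (col_mx (row_mx 0 (- Xm)) (row_mx 0 (- Um))).

Definition Nmat n m T (Xp Xm : 'M[R]_(n, T)) (Um : 'M[R]_(m, T))
  (Phi11 : 'M[R]_n) (Phi12 : 'M[R]_(n, T)) (Phi22 : 'M[R]_T) : 'M[R]_(n + (n + m)) :=
  Nfac Xp Xm Um *m Phi Phi11 Phi12 Phi22 *m (Nfac Xp Xm Um)^T.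

Definition informative_qs n m T (Xp Xm : 'M[R]_(n, T)) (Um : 'M[R]_(m, T))
  (Phi11 : 'M[R]_n) (Phi12 : 'M[R]_(n, T)) (Phi22 : 'M[R]_T) :=
  exists (K : 'M[R]_(m, n)) (P : 'M[R]_n), posdef P /\
    forall A B, Sigma Xp Xm Um Phi11 Phi12 Phi22 A B ->
      posdef (P - (A + B *m K) *m P *m (A + B *m K)^T).

Definition LMI_left n m (P : 'M[R]_n) (L : 'M[R]_(m, n)) (beta : R)
  : 'M[R]_(n + (n + m) + n) :=
  block_mx
    (block_mx (P - beta%:M) 0 0 (block_mx (- P) (- L^T) (- L) 0))
    (col_mx 0 (col_mx 0 L))
    (row_mx 0 (row_mx 0 L^T))
    P.

Definition LMI_right n m T (Xp Xm : 'M[R]_(n, T)) (Um : 'M[R]_(m, T))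
  (Phi11 : 'M[R]_n) (Phi12 : 'M[R]_(n, T)) (Phi22 : 'M[R]_T)
  : 'M[R]_(n + (n + m) + n) :=
  let F : 'M[R]_(n + (n + m) + n, n + T) := col_mx (Nfac Xp Xm Um) 0 in
  F *m Phi Phi11 Phi12 Phi22 *m F^T.

End Defs.

(* Main.v *)
(* With Z = [A B]^T and J = [I K^T], membership of (A, B) in Sigma reads N(v, Z v) >= 0
   for all v, and the Lyapunov inequality for A + B K reads M(v, Z v) > 0 for v <> 0,
   where M(v, x) = v^T P v - (J x)^T P (J x).  Completing the square in N, the Slater
   condition lets every (v, x) with v <> 0 and N(v, x) >= 0 be written as (v, Z v) with
   (A, B) in Sigma, so informativity becomes: N >= 0 and v <> 0 imply M > 0.  Sigma is
   unbounded along the kernel of [X-^T U-^T], which forces J to vanish there; hence M and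
   N only depend on v and y = [X-^T U-^T] x, the form y |-> N(0, y) is negative definite, and
   compactness of the sphere gives M(v, x) >= beta |v|^2 whenever N(v, x) >= 0.  The
   S-lemma for two quadratic forms then yields M - beta |v|^2 >= alpha N, and for L = K P
   the last block row of the LMI merely adds the square (z + K^T x2)^T P (z + K^T x2),
   where x2 is the second block of x. *)
Require Import Defs.
From HB Require Import structures.
From mathcomp Require Import all_boot all_order all_algebra.
From mathcomp Require Import reals.
From mathcomp.real_closed Require Import complex.
From mathcomp Require Import ring lra.
From mathcomp Require Import boolp classical_sets topology normedtype derive.
Import Order.TTheory GRing.Theory Num.Theory.
Import numFieldNormedType.Exports.
Local Open Scope ring_scope.

Set Implicit Arguments. Unset Strict Implicit. Unset Printing Implicit Defensive.

Section QuadraticMatrixInequalities.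
Variable R : realType.

(** * Bilinear and quadratic forms of matrices *)

Definition bil p q (M : 'M[R]_(p, q)) (u : 'cV[R]_p) (v : 'cV[R]_q) : R :=
  (u^T *m M *m v) 0 0.

Definition qf p (M : 'M[R]_p) (v : 'cV[R]_p) : R := bil M v v.

Definition sqn p (v : 'cV[R]_p) : R := qf 1%:M v.

Section Algebra.
Variables p q : nat.
Implicit Types (M N : 'M[R]_(p, q)) (u : 'cV[R]_p) (v w : 'cV[R]_q).

Lemma bil_sum M u v : bil M u v = \sum_j \sum_i u i 0 * M i j * v j 0.
Proof.
rewrite /bil mxE; apply: eq_bigr => j _; rewrite mxE big_distrl.
by apply: eq_bigr => i _; rewrite mxE.
Qed.

Lemma bilDr M u v w : bil M u (v + w) = bil M u v + bil M u w.
Proof. by rewrite /bil mulmxDr mxE. Qed.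

Lemma bilDl M u u' v : bil M (u + u') v = bil M u v + bil M u' v.
Proof. by rewrite /bil linearD !mulmxDl mxE. Qed.

Lemma bilNr M u v : bil M u (- v) = - bil M u v.
Proof. by rewrite /bil mulmxN mxE. Qed.

Lemma bilNl M u v : bil M (- u) v = - bil M u v.
Proof. by rewrite /bil linearN !mulNmx mxE. Qed.

Lemma bilZr M a u v : bil M u (a *: v) = a * bil M u v.
Proof. by rewrite /bil -scalemxAr mxE. Qed.

Lemma bilZl M a u v : bil M (a *: u) v = a * bil M u v.
Proof. by rewrite /bil linearZ -!scalemxAl mxE. Qed.

Lemma bil0l M v : bil M 0 v = 0.
Proof. by rewrite /bil trmx0 !mul0mx mxE. Qed.

Lemma bil_mx0 u v : bil 0 u v = 0.
Proof. by rewrite /bil mulmx0 mul0mx mxE. Qed.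

Lemma bil_mxD M N u v : bil (M + N) u v = bil M u v + bil N u v.
Proof. by rewrite /bil mulmxDr mulmxDl mxE. Qed.

Lemma bil_mxN M u v : bil (- M) u v = - bil M u v.
Proof. by rewrite /bil mulmxN mulNmx mxE. Qed.

Lemma bil_mxZ a M u v : bil (a *: M) u v = a * bil M u v.
Proof. by rewrite /bil -scalemxAr -scalemxAl mxE. Qed.

Lemma bil_tr M u v : bil M^T v u = bil M u v.
Proof.
rewrite /bil (_ : v^T *m _ *m _ = (u^T *m M *m v)^T); first by rewrite mxE.
by rewrite !trmx_mul trmxK mulmxA.
Qed.

Lemma bil_mul p' q' M (A : 'M_(p, p')) (B : 'M_(q, q'))
    (u' : 'cV_p') (v' : 'cV_q') :
  bil M (A *m u') (B *m v') = bil (A^T *m M *m B) u' v'.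
Proof. by rewrite /bil trmx_mul !mulmxA. Qed.

Lemma bil_mull p' M (A : 'M_(p, p')) (u' : 'cV_p') v :
  bil M (A *m u') v = bil (A^T *m M) u' v.
Proof. by rewrite /bil trmx_mul !mulmxA. Qed.

Lemma bil_mulr q' M (B : 'M_(q, q')) u (v' : 'cV_q') :
  bil M u (B *m v') = bil (M *m B) u v'.
Proof. by rewrite /bil !mulmxA. Qed.

End Algebra.

Lemma bil_block p1 p2 q1 q2 (A : 'M[R]_(p1, q1)) B C (D : 'M_(p2, q2)) a b c d :
  bil (block_mx A B C D) (col_mx a b) (col_mx c d) =
  bil A a c + bil B a d + bil C b c + bil D b d.
Proof.
rewrite /bil tr_col_mx mul_row_block mul_row_col !mulmxDl !mxE; ring.
Qed.

Lemma bil_col_mx p1 p2 q (A : 'M[R]_(p1, q)) (B : 'M_(p2, q)) a b c :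
  bil (col_mx A B) (col_mx a b) c = bil A a c + bil B b c.
Proof. by rewrite /bil tr_col_mx mul_row_col mulmxDl mxE. Qed.

Lemma bil_row_mx p q1 q2 (A : 'M[R]_(p, q1)) (B : 'M_(p, q2)) a b c :
  bil (row_mx A B) a (col_mx b c) = bil A a b + bil B a c.
Proof. by rewrite /bil mul_mx_row mul_row_col mxE. Qed.

Lemma bil_symmx p (M : 'M[R]_p) u v : symmx M -> bil M u v = bil M v u.
Proof. by move=> Msym; rewrite -{1}Msym bil_tr. Qed.

Section QuadraticForms.
Variable p : nat.
Implicit Types (M N : 'M[R]_p) (u v : 'cV[R]_p).

Lemma qfZ M a v : qf M (a *: v) = a ^+ 2 * qf M v.
Proof. by rewrite /qf bilZl bilZr mulrA expr2. Qed.

Lemma qfD M u v : qf M (u + v) = qf M u + (bil M u v + bil M v u) + qf M v.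
Proof. by rewrite /qf !(bilDl, bilDr); ring. Qed.

Lemma qf_mul q M (A : 'M_(p, q)) (v : 'cV_q) : qf M (A *m v) = qf (A^T *m M *m A) v.
Proof. exact: bil_mul. Qed.

Lemma sqn_sum v : sqn v = \sum_i v i 0 ^+ 2.
Proof.
rewrite /sqn /qf /bil mulmx1 mxE; apply: eq_bigr => i _.
by rewrite mxE expr2.
Qed.

Lemma sqn_ge0 v : 0 <= sqn v.
Proof. by rewrite sqn_sum sumr_ge0 // => i _; exact: sqr_ge0. Qed.

Lemma sqn_eq0 v : (sqn v == 0) = (v == 0).
Proof.
apply/idP/eqP => [|->]; last by rewrite /sqn /qf bil0l.
rewrite sqn_sum psumr_eq0 => [/allP v0|i _]; last exact: sqr_ge0.
apply/matrixP => i j; rewrite ord1 mxE; apply/eqP.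
by have := v0 i (mem_index_enum _); rewrite sqrf_eq0.
Qed.

Lemma sqn_gt0 v : (0 < sqn v) = (v != 0).
Proof. by rewrite lt_def sqn_ge0 andbT sqn_eq0. Qed.

Lemma posdef_qf_gt0 M v : posdef M -> v != 0 -> 0 < qf M v.
Proof. by case=> _ /[apply]. Qed.

Lemma posdef_qf_ge0 M v : posdef M -> 0 <= qf M v.
Proof.
move=> Mpos; have [->|v0] := eqVneq v 0; first by rewrite /qf bil0l.
exact/ltW/posdef_qf_gt0.
Qed.

End QuadraticForms.

(** * Continuity and coercivity of quadratic forms *)

Lemma qf_continuous p (M : 'M[R]_p) : continuous (fun x : 'rV[R]_p => qf M x^T).
Proof.
have -> : (fun x : 'rV[R]_p => qf M x^T) =
    (fun x => \sum_j \sum_i x 0 i * M i j * x 0 j).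
  apply/funext => x; rewrite /qf bil_sum; apply: eq_bigr => j _.
  by apply: eq_bigr => i _; rewrite !mxE.
apply: continuous_big => [|j _]; first exact: add_continuous.
apply: continuous_big => [|i _ x]; first exact: add_continuous.
have cx k : {for x, continuous (fun y : 'rV[R]_p => y 0 k)}.
  exact: coord_continuous.
have cM : {for x, continuous (fun y : 'rV[R]_p => M i j)} by exact: cst_continuous.
exact: (continuousM (continuousM (cx i) cM) (cx j)).
Qed.

(** The minimum of [G] over the compact part of the unit sphere cut out by both constraints serves
    as [beta], and homogeneity of degree 2 extends the bound to all [v]. The second constraint makes
    room for a linear side condition, written as minus a square being nonnegative. *)
Lemma posform_coercive p (F H G : 'M[R]_p) :
  (forall v, v != 0 -> 0 <= qf F v -> 0 <= qf H v -> 0 < qf G v) ->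
  exists2 beta, 0 < beta &
    forall v, 0 <= qf F v -> 0 <= qf H v -> beta * sqn v <= qf G v.
Proof.
move=> Gpos.
pose S := ([set x : 'rV[R]_p | qf 1%:M x^T = 1] `&`
  ([set x | 0 <= qf F x^T] `&` [set x | 0 <= qf H x^T]))%classic.
have cl_preim M (A : set R) :
    closed A -> closed [set x : 'rV[R]_p | A (qf M x^T)]%classic.
  by move=> cA; apply: (closed_comp _ cA) => x _; exact: qf_continuous.
have cI : compact [set x : 'rV[R]_p | forall i, `[-1, 1]%classic (x ord0 i)]%classic.
  by apply: (@rV_compact R p (fun=> `[-1, 1]%classic)) => _; exact: segment_compact.
have cS : compact S.
  apply: subclosed_compact cI _.
    apply: closedI; first exact: (cl_preim 1%:M _ (@closed_eq R 1)).
    exact: closedI (cl_preim F _ (@closed_ge R 0)) (cl_preim H _ (@closed_ge R 0)).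
  move=> x [x1 _] i; rewrite /= in_itv /= -ler_norml.
  rewrite -(@expr_le1 _ 2) // real_normK ?num_real // -[leRHS]x1 -/(sqn _) sqn_sum.
  by rewrite (bigD1 i) //= mxE lerDl sumr_ge0 // => j _; exact: sqr_ge0.
have [[x0 Sx0]|S0] := pselect (S !=set0)%classic; last first.
  (* If [S] is empty, normalising a nonzero admissible [v] would give a point of it; only [v = 0] is
     left and any positive constant works. *)
  exists 1 => // v Fv Hv; have [->|v0] := eqVneq v 0.
    by rewrite /sqn /qf !bil0l mulr0.
  case: S0; exists ((Num.sqrt (sqn v))^-1 *: v)^T.
  rewrite /S /= trmxK /sqn !qfZ exprVn sqr_sqrtr ?sqn_ge0 // mulVf ?sqn_eq0 //.
  by split=> //; split; rewrite mulr_ge0 ?invr_ge0 ?sqn_ge0.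
have [] := @EVT_min_rV _ _ (fun x => qf G x^T) S _ cS.
- by exists x0.
- by apply: continuous_subspaceT; exact: qf_continuous.
move=> c; rewrite inE => -[c1 [Fc Hc]] minc; exists (qf G c^T).
  by apply: Gpos => //; rewrite -sqn_gt0 /sqn c1.
move=> v Fv Hv; have [->|v0] := eqVneq v 0.
  by rewrite /sqn /qf !bil0l mulr0.
have sv : 0 < sqn v by rewrite sqn_gt0.
have /minc : ((Num.sqrt (sqn v))^-1 *: v)^T \in S.
  rewrite inE /S /= trmxK !qfZ exprVn sqr_sqrtr ?sqn_ge0 // mulVf ?sqn_eq0 //.
  by split=> //; split; rewrite mulr_ge0 ?invr_ge0 ?sqn_ge0.
by rewrite trmxK qfZ exprVn sqr_sqrtr ?sqn_ge0 // mulrC ler_pdivlMr.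
Qed.

(** * The S-lemma *)

(* The two real roots [s1 < 0 < s2] of [a s^2 + c s + b] satisfy [s1 s2 = b / a];
   weighting the two resulting inequalities by [s2] and [- s1] cancels [d]. *)
Lemma quadratic_ratio_le (a b c d e f : R) :
  a < 0 -> 0 < b ->
  (forall s, 0 <= s ^+ 2 * a + s * c + b -> 0 <= s ^+ 2 * e + s * d + f) ->
  e / a <= f / b.
Proof.
move=> a0 b0 imp; pose D := Num.sqrt (c ^+ 2 - 4 * a * b).
have DD : D ^+ 2 = c ^+ 2 - 4 * a * b by rewrite sqr_sqrtr //; nra.
have D0 : 0 <= D by exact: sqrtr_ge0.
have aN0 : a != 0 by rewrite lt_eqF.
pose s1 := (- c + D) / (2 * a); pose s2 := (- c - D) / (2 * a).
have root1 : s1 ^+ 2 * a + s1 * c + b = 0.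
  have -> : s1 ^+ 2 * a + s1 * c + b = (D ^+ 2 - c ^+ 2 + 4 * a * b) / (4 * a).
    by rewrite /s1; field.
  by rewrite DD [X in X / _](_ : _ = 0) ?mul0r //; ring.
have root2 : s2 ^+ 2 * a + s2 * c + b = 0.
  have -> : s2 ^+ 2 * a + s2 * c + b = (D ^+ 2 - c ^+ 2 + 4 * a * b) / (4 * a).
    by rewrite /s2; field.
  by rewrite DD [X in X / _](_ : _ = 0) ?mul0r //; ring.
have prod : s1 * s2 * a = b.
  have -> : s1 * s2 * a = (c ^+ 2 - D ^+ 2) / (4 * a) by rewrite /s1 /s2; field.
  by rewrite DD; field.
(* As [a * b < 0], the discriminant exceeds [c ^+ 2], so the two roots have opposite signs. *)
have cD : `|c| < D.
  by rewrite -(@ltr_pXn2r _ 2) ?nnegrE // DD real_normK ?num_real //; nra.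
move: cD; rewrite ltr_norml => /andP[cD1 cD2].
have s1_lt0 : s1 < 0 by rewrite /s1 nmulr_llt0 ?invr_lt0; lra.
have s2_gt0 : 0 < s2 by rewrite /s2 nmulr_lgt0 ?invr_lt0; lra.
have := imp s1; rewrite root1 => /(_ (lexx _)) im1.
have := imp s2; rewrite root2 => /(_ (lexx _)) im2.
have : 0 <= (s2 - s1) * (f - s1 * s2 * e).
  have -> : (s2 - s1) * (f - s1 * s2 * e) =
    s2 * (s1 ^+ 2 * e + s1 * d + f) + (- s1) * (s2 ^+ 2 * e + s2 * d + f) by ring.
  by rewrite addr_ge0 // mulr_ge0 //; lra.
rewrite pmulr_rge0; last lra.
rewrite subr_ge0 => le_f; rewrite ler_pdivlMr // -prod.
by rewrite [leLHS](_ : _ = s1 * s2 * e) //; field.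
Qed.

(** Ratios [qf M x / qf N x] with [qf N x < 0] are bounded by all those with [qf N y > 0], and
    [alpha] is the supremum of the former. Adding 0 to the set makes [alpha] nonnegative and keeps
    the set nonempty when [N] is never negative. *)
Lemma s_lemma p (N M : 'M[R]_p) :
  (exists y, 0 < qf N y) -> (forall x, 0 <= qf N x -> 0 <= qf M x) ->
  exists2 alpha, 0 <= alpha & forall x, alpha * qf N x <= qf M x.
Proof.
move=> [y0 Ny0] NM.
have ratio x y : qf N x < 0 -> 0 < qf N y -> qf M x / qf N x <= qf M y / qf N y.
  (* Along [s *: x + y] both forms are quadratic polynomials in [s], whose leading and constant
     coefficients are their values at [x] and [y]. *)
  move=> Nx Ny; pose cross L := bil L x y + bil L y x.
  have qf_line L s : s ^+ 2 * qf L x + s * cross L + qf L y = qf L (s *: x + y).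
    by rewrite qfD qfZ bilZl bilZr -mulrDr.
  apply: (quadratic_ratio_le (c := cross N) (d := cross M)) => // s.
  by rewrite !qf_line; exact: NM.
pose A := [set a | a = 0 \/ exists2 x, qf N x < 0 & a = qf M x / qf N x]%classic.
have ubA y : 0 < qf N y -> ubound A (qf M y / qf N y).
  move=> Ny a [->|[x Nx ->]]; last exact: ratio.
  by rewrite divr_ge0 ?NM // ltW.
have bA : has_ubound A by exists (qf M y0 / qf N y0); exact: ubA.
exists (sup A) => [|x]; first by apply: ub_le_sup => //; left.
have [Nx|Nx|Nx] := ltgtP (qf N x) 0.
- by rewrite -ler_ndivrMr //; apply: ub_le_sup => //; right; exists x.
- by rewrite -ler_pdivlMr //; apply: ge_sup; [exists 0; left|exact: ubA].
- by rewrite Nx mulr0 NM // Nx.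
Qed.

(** * Factorization through kernels, interpolation and definite matrices *)

(** The columns of [cokermx B] lie in the kernel of [B], hence in that of [A]. Through [submxP] this
    turns a kernel inclusion into a factorization [A = G *m B]. *)
Lemma submx_of_ker p q r (A : 'M[R]_(p, r)) (B : 'M[R]_(q, r)) :
  (forall c : 'cV_r, B *m c = 0 -> A *m c = 0) -> (A <= B)%MS.
Proof.
move=> kerBA; rewrite submxE; apply/eqP/matrixP => i j.
have /kerBA/colP/(_ i) : B *m col j (cokermx B) = 0.
  by rewrite colE mulmxA mulmx_coker mul0mx.
by rewrite colE mulmxA -colE !mxE.
Qed.

(* A rank-one [E], aligned with [x] for the inner product [S], suffices. *)
Lemma interpolate_qmi n q (S : 'M[R]_n) (H : 'M[R]_q) x e :
  symmx S -> (forall v, 0 <= qf S v) -> 0 < qf S x -> 0 <= qf S x + qf H e ->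
  exists2 E : 'M_(q, n), E *m x = e & forall v, 0 <= qf S v + qf H (E *m v).
Proof.
move=> Ssym S0 Sx He.
have Ev v : (qf S x)^-1 *: (e *m (x^T *m S)) *m v = (bil S x v / qf S x) *: e.
  rewrite -scalemxAl -mulmxA [_ *m v]mx11_scalar mul_mx_scalar scalerA.
  by rewrite mulrC /bil.
exists ((qf S x)^-1 *: (e *m (x^T *m S))) => [|v].
  by rewrite Ev divff ?scale1r // gt_eqF.
rewrite Ev qfZ; set b := bil S x v; set s := qf S x in Sx He *.
(* Cauchy-Schwarz for the semidefinite form [S], read off from its value at [s *: v - b *: x]. *)
have cs : b ^+ 2 <= s * qf S v.
  have := S0 (s *: v - b *: x).
  rewrite qfD -scaleNr !qfZ !(bilZl, bilZr) (bil_symmx v x Ssym) -/b -/s.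
  rewrite [X in 0 <= X](_ : _ = s * (s * qf S v - b ^+ 2)); last ring.
  by rewrite pmulr_rge0 // subr_ge0.
have : 0 <= (b / s) ^+ 2 * (s + qf H e) by rewrite mulr_ge0 ?sqr_ge0.
rewrite mulrDr => Hb; apply: le_trans Hb _; rewrite lerD2r.
have -> : (b / s) ^+ 2 * s = b ^+ 2 / s by field; rewrite gt_eqF.
by rewrite ler_pdivrMr // mulrC.
Qed.

Lemma symmx_block p q (A : 'M[R]_p) (B : 'M_(p, q)) (C : 'M_q) :
  symmx A -> symmx C -> symmx (block_mx A B B^T C).
Proof. by move=> sA sC; rewrite /symmx tr_block_mx trmxK sA sC. Qed.

Lemma symmx_congr p q (A : 'M[R]_p) (B : 'M_(p, q)) :
  symmx A -> symmx (B^T *m A *m B).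
Proof. by move=> sA; rewrite /symmx !trmx_mul trmxK sA mulmxA. Qed.

Lemma negdef_qf_lt0 p (M : 'M[R]_p) v : negdef M -> v != 0 -> qf M v < 0.
Proof. by move=> Mneg /(posdef_qf_gt0 Mneg); rewrite /qf bil_mxN oppr_gt0. Qed.

Lemma negdef_qf_le0 p (M : 'M[R]_p) v : negdef M -> qf M v <= 0.
Proof. by move=> /(posdef_qf_ge0 v); rewrite /qf bil_mxN oppr_ge0. Qed.

Lemma posdef_unitmx p (M : 'M[R]_p) : posdef M -> M \in unitmx.
Proof.
move=> Mpos; rewrite -row_full_unit -sub1mx; apply: submx_of_ker => c Mc.
apply/eqP; rewrite mul1mx; apply: contraT => /(posdef_qf_gt0 Mpos).
by rewrite /qf /bil -mulmxA Mc mulmx0 mxE ltxx.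
Qed.

(** * Matrix ellipsoids and the data-consistent set *)

Section Noise.
Variables (n T : nat) (Phi11 : 'M[R]_n) (Phi12 : 'M[R]_(n, T)) (Phi22 : 'M[R]_T).
Hypotheses (sPhi11 : symmx Phi11) (sPhi22 : symmx Phi22) (Phi22_neg : negdef Phi22).
Local Notation Phi := (Phi Phi11 Phi12 Phi22).

Lemma symmx_Phi : symmx Phi. Proof. exact: symmx_block. Qed.

Lemma qf_Phi v y :
  qf Phi (col_mx v y) = qf Phi11 v + 2 * bil Phi12 v y + qf Phi22 y.
Proof. rewrite /qf bil_block bil_tr; ring. Qed.

Lemma noise_okP W :
  noise_ok Phi11 Phi12 Phi22 W <-> forall v, 0 <= qf Phi (col_mx v (W^T *m v)).
Proof.
have qW v : qf ((col_mx 1%:M W^T)^T *m Phi *m col_mx 1%:M W^T) v =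
    qf Phi (col_mx v (W^T *m v)).
  by rewrite -qf_mul mul_col_mx mul1mx.
split=> [[_ W0] v|W0]; first by rewrite -qW; exact: W0.
by split=> [|v]; [exact/symmx_congr/symmx_Phi|rewrite -/(bil _ _ _) -/(qf _ _) qW].
Qed.

(* [Zc] is the centre of the matrix ellipsoid of all [Z] compatible with the data
   and [S] its radius; it exists although [D] need not have full row rank. *)
Lemma complete_square q (X : 'M[R]_(n, T)) (D : 'M[R]_(q, T)) :
  exists (S : 'M[R]_n) (Zc : 'M[R]_(q, n)), symmx S /\
    forall v x, qf Phi (col_mx v (X^T *m v - D^T *m x)) =
      qf S v + qf (D *m Phi22 *m D^T) (x - Zc *m v).
Proof.
(* The normal equation for the centre is solvable because, [Phi22] being definite,
   [D *m Phi22 *m D^T] has the same kernel as [D^T]. *)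
have [Zt HZt] : exists Zt : 'M_(n, q),
    (Phi12 + X *m Phi22) *m D^T = Zt *m (D *m Phi22 *m D^T).
  apply/submxP/submx_of_ker => c Dc; rewrite -mulmxA.
  suff -> : D^T *m c = 0 by rewrite mulmx0.
  apply/eqP; apply: contraT => /(negdef_qf_lt0 Phi22_neg).
  by rewrite qf_mul trmxK /qf /bil -mulmxA Dc mulmx0 mxE ltxx.
pose Y := X^T - D^T *m Zt^T; pose E := col_mx 1%:M Y.
exists (E^T *m Phi *m E), Zt^T; split; first exact/symmx_congr/symmx_Phi.
move=> v x; rewrite -qf_mul mul_col_mx mul1mx.
set h := x - _; have -> : X^T *m v - D^T *m x = Y *m v + - (D^T *m h).
  by rewrite /Y /h mulmxBl mulmxBr opprB mulmxA addrA subrK.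
have -> : D *m Phi22 *m D^T = D^T^T *m Phi22 *m D^T by rewrite trmxK.
rewrite -qf_mul !qf_Phi bilDr bilNr qfD.
have -> : qf Phi22 (- (D^T *m h)) = qf Phi22 (D^T *m h).
  by rewrite /qf bilNl bilNr opprK.
have -> : bil Phi22 (- (D^T *m h)) (Y *m v) = bil Phi22 (Y *m v) (- (D^T *m h)).
  exact: bil_symmx.
(* The normal equation for [Zt] makes the part linear in [h] vanish. *)
have : bil Phi12 v (D^T *m h) + bil Phi22 (Y *m v) (D^T *m h) = 0.
  rewrite bil_mul bil_mulr -bil_mxD -mulmxDl.
  rewrite (_ : _ *m D^T = 0) ?bil_mx0 //.
  by rewrite /Y linearB /= trmx_mul !trmxK mulmxBl addrA mulmxBl HZt !mulmxA subrr.
rewrite bilNr => cross0; lra.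
Qed.

End Noise.

Section Data.
Variables (n m T : nat) (Xp Xm : 'M[R]_(n, T)) (Um : 'M[R]_(m, T)).
Variables (Phi11 : 'M[R]_n) (Phi12 : 'M[R]_(n, T)) (Phi22 : 'M[R]_T).
Hypotheses (sPhi11 : symmx Phi11) (sPhi22 : symmx Phi22) (Phi22_neg : negdef Phi22).

Local Notation Phi := (Phi Phi11 Phi12 Phi22).
Local Notation N := (Nmat Xp Xm Um Phi11 Phi12 Phi22).
Local Notation D := (col_mx Xm Um).
Local Notation Sig := (Sigma Xp Xm Um Phi11 Phi12 Phi22).

Lemma qf_Nmat v x :
  qf N (col_mx v x) = qf Phi (col_mx v (Xp^T *m v - D^T *m x)).
Proof.
have -> : N = (Nfac Xp Xm Um)^T^T *m Phi *m (Nfac Xp Xm Um)^T by rewrite trmxK.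
rewrite -qf_mul; congr (qf _ _); rewrite -[x]vsubmxK /Nfac.
rewrite !tr_col_mx !tr_row_mx !mul_row_col !mul_col_mx !add_col_mx.
by rewrite !trmx0 trmx1 !mul0mx mul1mx !addr0 [(- Xm)^T]linearN [(- Um)^T]linearN
  /= !mulNmx opprD.
Qed.

(** The noise [W] is forced to be the residual [Xp - (A *m Xm + B *m Um)], so the existential in
    [Sigma] disappears. *)
Lemma SigmaP A B :
  Sig A B <-> forall v, 0 <= qf N (col_mx v (col_mx A^T B^T *m v)).
Proof.
have qW W v : Xp = A *m Xm + B *m Um + W ->
    qf N (col_mx v (col_mx A^T B^T *m v)) = qf Phi (col_mx v (W^T *m v)).
  move=> eqX; rewrite qf_Nmat.
  have -> : W^T = Xp^T - (Xm^T *m A^T + Um^T *m B^T).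
    rewrite eqX -!trmx_mul [(_ + W)^T]linearD /= [(_ + _)^T]linearD /=.
    by rewrite addrAC subrr add0r.
  by rewrite mulmxBl mulmxA tr_col_mx mul_row_col.
split=> [[W [eqX /(noise_okP Phi12 sPhi11 sPhi22) W0]] v|N0].
  by rewrite (qW W).
exists (Xp - (A *m Xm + B *m Um)).
have eqX : Xp = A *m Xm + B *m Um + (Xp - (A *m Xm + B *m Um)) by rewrite addrC subrK.
by split=> //; apply/(noise_okP Phi12 sPhi11 sPhi22) => v; rewrite -qW.
Qed.

Hypothesis slater : exists Zbar : 'M[R]_(n + m, n),
  posdef ((col_mx 1%:M Zbar)^T *m N *m col_mx 1%:M Zbar).

Lemma slater_vec v : v != 0 -> exists x, 0 < qf N (col_mx v x).
Proof.
move=> v0; have [Z /posdef_qf_gt0 /(_ v0)] := slater.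
by rewrite -qf_mul mul_col_mx mul1mx; exists (Z *m v).
Qed.

(** Since [N] at [(v, x)] is at most [qf S v], the Slater condition makes [S] positive definite.
    Interpolation then gives a deviation [E] from the centre with [E *m v = x - Zc *m v] that stays
    in the ellipsoid, and [Zc + E] is split into [A^T] and [B^T]. *)
Lemma Sigma_lift v x : v != 0 -> 0 <= qf N (col_mx v x) ->
  exists A B, Sig A B /\ col_mx A^T B^T *m v = x.
Proof.
have [S [Zc [sS sqE]]] := complete_square Phi12 sPhi11 sPhi22 Phi22_neg Xp D.
have qN u y : qf N (col_mx u y) = qf S u + qf (D *m Phi22 *m D^T) (y - Zc *m u).
  by rewrite qf_Nmat sqE.
have le0 y : qf (D *m Phi22 *m D^T) y <= 0.
  have -> : D *m Phi22 *m D^T = D^T^T *m Phi22 *m D^T by rewrite trmxK.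
  by rewrite -qf_mul; exact: negdef_qf_le0.
have S_gt0 u : u != 0 -> 0 < qf S u.
  move=> /slater_vec[y]; rewrite qN => /lt_le_trans; apply.
  by rewrite gerDl.
have S_ge0 u : 0 <= qf S u.
  by have [->|/S_gt0/ltW //] := eqVneq u 0; rewrite /qf bil0l.
move=> v0; rewrite qN => /(interpolate_qmi sS S_ge0 (S_gt0 v v0))[E Ev HE].
have defZ : col_mx (usubmx (Zc + E))^T^T (dsubmx (Zc + E))^T^T = Zc + E.
  by rewrite !trmxK vsubmxK.
exists (usubmx (Zc + E))^T, (dsubmx (Zc + E))^T; split.
  by apply/SigmaP => u; rewrite defZ qN mulmxDl [_ - Zc *m u]addrC addKr.
by rewrite defZ mulmxDl Ev addrC subrK.
Qed.

End Data.

(** * Robust stabilization *)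

Lemma qf_stein n (P C : 'M[R]_n) v :
  qf (P - C *m P *m C^T) v = qf P v - qf P (C^T *m v).
Proof. by rewrite qf_mul trmxK /qf bil_mxD bil_mxN. Qed.

Lemma symmx_stein n (P C : 'M[R]_n) : symmx P -> symmx (P - C *m P *m C^T).
Proof.
move=> sP; rewrite /symmx [(P - _)^T]linearB /= sP; congr (_ - _).
by have := symmx_congr C^T sP; rewrite trmxK.
Qed.

(** For a left eigenvector [w] with real and imaginary parts [x], [y], adding the Stein form at [x]
    and at [y] cancels the cross terms and leaves [1 - (a ^+ 2 + b ^+ 2)] times
    [qf P x + qf P y]. *)
Lemma stein_schur_stable n (P C : 'M[R]_n) :
  posdef P -> posdef (P - C *m P *m C^T) -> schur_stable C.
Proof.
move=> Ppos Qpos lam /eigenvalueP[w wC w0].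
pose x := (map_mx (@complex.Re R) w)^T; pose y := (map_mx (@complex.Im R) w)^T.
case: lam wC => a b wC.
have xC : C^T *m x = a *: x - b *: y.
  apply/colP => i; transitivity (complex.Re ((a +i* b)%C * w 0 i)); last first.
    by rewrite !mxE; case: (w 0 i).
  have /rowP/(_ i) := wC; rewrite !mxE => <-; rewrite raddf_sum.
  apply: eq_bigr => j _; rewrite !mxE.
  by case: (w 0 j) => u v /=; rewrite mulr0 subr0 mulrC.
have yC : C^T *m y = b *: x + a *: y.
  apply/colP => i; transitivity (complex.Im ((a +i* b)%C * w 0 i)); last first.
    by rewrite !mxE; case: (w 0 i) => u v /=; rewrite addrC.
  have /rowP/(_ i) := wC; rewrite !mxE => <-; rewrite raddf_sum.
  apply: eq_bigr => j _; rewrite !mxE.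
  by case: (w 0 j) => u v /=; rewrite mulr0 add0r mulrC.
have xy0 : (x != 0) || (y != 0).
  rewrite -negb_and; apply: contra w0 => /andP[/eqP x0 /eqP y0].
  apply/eqP/rowP => i; rewrite mxE.
  have := congr1 (fun z : 'cV_n => z i 0) x0; have := congr1 (fun z : 'cV_n => z i 0) y0.
  by rewrite !mxE; case: (w 0 i) => u v /= -> ->.
have sum_gt0 M : posdef M -> 0 < qf M x + qf M y.
  move=> Mpos; case/orP: xy0 => /(posdef_qf_gt0 Mpos) gt0.
    by rewrite ltr_pwDl ?posdef_qf_ge0.
  by rewrite ltr_wpDl ?posdef_qf_ge0.
have := sum_gt0 _ Qpos; have := sum_gt0 _ Ppos.
rewrite !qf_stein xC yC -scaleNr !qfD !qfZ !bilZl !bilZr.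
set p := qf P x; set q := qf P y; set r := bil P x y; set s := bil P y x => pq0 h.
have ab1 : a ^+ 2 + b ^+ 2 < 1.
  move: h; rewrite [X in 0 < X](_ : _ = (p + q) * (1 - (a ^+ 2 + b ^+ 2))); last ring.
  by rewrite pmulr_rgt0 // subr_gt0.
rewrite normc_def ltcR /=.
by rewrite -sqrtr1 ltr_sqrt.
Qed.

(** * The linear matrix inequality and its sufficiency *)

Section Feedback.
Variables (n m T : nat) (Xp Xm : 'M[R]_(n, T)) (Um : 'M[R]_(m, T)).
Variables (Phi11 : 'M[R]_n) (Phi12 : 'M[R]_(n, T)) (Phi22 : 'M[R]_T).
Hypotheses (sPhi11 : symmx Phi11) (sPhi22 : symmx Phi22) (Phi22_neg : negdef Phi22).

Local Notation Phi := (Phi Phi11 Phi12 Phi22).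
Local Notation N := (Nmat Xp Xm Um Phi11 Phi12 Phi22).
Local Notation D := (col_mx Xm Um).
Local Notation Sig := (Sigma Xp Xm Um Phi11 Phi12 Phi22).
Local Notation LMI P L alpha beta :=
  (LMI_left P L beta - alpha *: LMI_right Xp Xm Um Phi11 Phi12 Phi22).
Local Notation J K := (row_mx 1%:M K^T).

Lemma closed_loop_tr (A : 'M[R]_n) (B : 'M[R]_(n, m)) (K : 'M[R]_(m, n)) :
  (A + B *m K)^T = J K *m col_mx A^T B^T.
Proof. by rewrite mul_row_col mul1mx -trmx_mul linearD. Qed.

(** The square in [z] contains [qf P (K^T *m dsubmx x)], which cancels the same term of
    [qf P (J K *m x)]; this is why the third diagonal block of the LMI can be 0. *)
Lemma qf_LMI P (K : 'M[R]_(m, n)) alpha beta v x z : symmx P ->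
  qf (LMI P (K *m P) alpha beta) (col_mx (col_mx v x) z) =
  qf P v - beta * sqn v - qf P (J K *m x : 'cV_n) + qf P (z + K^T *m dsubmx x)
  - alpha * qf N (col_mx v x).
Proof.
move=> sP; rewrite /qf bil_mxD bil_mxN bil_mxZ -!/(qf _ _).
have -> : qf (LMI_right Xp Xm Um Phi11 Phi12 Phi22) (col_mx (col_mx v x) z) =
    qf N (col_mx v x).
  transitivity (qf Phi ((col_mx (Nfac Xp Xm Um) 0)^T *m (col_mx (col_mx v x) z))).
    by rewrite qf_mul trmxK.
  rewrite tr_col_mx mul_row_col trmx0 mul0mx addr0.
  by rewrite qf_mul trmxK.
congr (_ - _); rewrite -[x]vsubmxK; move: (usubmx x) (dsubmx x) => a b.
rewrite col_mxKd mul_row_col mul1mx /LMI_left /qf !bil_block !bil_col_mx !bil_row_mx.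
rewrite !bil_mx0 !addr0 !add0r bil_mxD !bil_mxN !bil_tr.
have bil_KP c : bil (K *m P) b c = bil P (K^T *m b) c by rewrite bil_mull trmxK.
rewrite !bil_KP -scalemx1 bil_mxZ /sqn /qf; move: (K^T *m b) => w.
by rewrite !(bilDl, bilDr) (bil_symmx a w sP) (bil_symmx z w sP); ring.
Qed.

Lemma symmx_LMI P L alpha beta : symmx P -> symmx (LMI P L alpha beta).
Proof.
move=> sP; rewrite /symmx [(_ - _)^T]linearB /= [(_ *: _)^T]linearZ /=.
congr (_ - _ *: _).
  rewrite /LMI_left !tr_block_mx !tr_col_mx !tr_row_mx !trmx0 !trmxK sP.
  by rewrite ![(- _)^T]linearN /= trmxK sP [(_ - _)^T]linearB /= sP tr_scalar_mx.
rewrite /LMI_right; set F := col_mx _ 0.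
by have := symmx_congr F^T (symmx_Phi Phi12 sPhi11 sPhi22); rewrite trmxK.
Qed.

Lemma LMI_robust P (L : 'M[R]_(m, n)) alpha beta A B :
  posdef P -> 0 <= alpha -> 0 < beta -> possemidef (LMI P L alpha beta) ->
  Sig A B ->
  posdef (P - (A + B *m (L *m invmx P)) *m P *m (A + B *m (L *m invmx P))^T).
Proof.
move=> Ppos alpha0 beta0 [_ LMI0] /(SigmaP _ _ _ _ sPhi11 sPhi22) N0.
set K := L *m invmx P.
have defL : L = K *m P by rewrite /K mulmxKV // posdef_unitmx.
have sP : symmx P by case: Ppos.
split=> [|v v0]; first exact: symmx_stein.
rewrite -/(bil _ _ _) -/(qf _ _) qf_stein closed_loop_tr -mulmxA.
set x := col_mx A^T B^T *m v.
(* This choice of the last block makes the square in [z] zero, as in a Schur complement. *)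
have := LMI0 (col_mx (col_mx v x) (- (K^T *m dsubmx x))).
rewrite -/(bil _ _ _) -/(qf _ _) defL qf_LMI // addNr {3}/qf bil0l addr0.
have : 0 <= alpha * qf N (col_mx v x) by rewrite mulr_ge0 // N0.
have : 0 < beta * sqn v by rewrite mulr_gt0 // sqn_gt0.
lra.
Qed.

(** * Necessity of the linear matrix inequality *)

Section Robust.
Variables (P : 'M[R]_n) (K : 'M[R]_(m, n)).
Hypothesis P_pos : posdef P.
Hypothesis robust : forall A B, Sig A B ->
  posdef (P - (A + B *m K) *m P *m (A + B *m K)^T).

Lemma robust_gt0 A B v : Sig A B -> v != 0 ->
  0 < qf P v - qf P (J K *m (col_mx A^T B^T *m v) : 'cV_n).
Proof.
by move=> /robust/posdef_qf_gt0 /[apply]; rewrite qf_stein closed_loop_tr mulmxA.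
Qed.

(* Otherwise moving [Z0] along [c] in both directions stays in [Sigma] and
   pushes [A + B K] out of the ellipsoid defined by [P]. *)
Lemma robust_ker (c : 'cV_(n + m)) :
  (exists A B, Sig A B) -> D^T *m c = 0 -> J K *m c = 0 :> 'cV_n.
Proof.
move=> [A0 [B0 /(SigmaP _ _ _ _ sPhi11 sPhi22) N0]] Dc.
set Z0 := col_mx A0^T B0^T in N0; pose u : 'cV_n := J K *m c.
apply/eqP; apply: contraT; rewrite -/u => u0.
have u_gt0 := sqn_gt0 u; rewrite u0 in u_gt0.
pose r : 'cV_n := J K *m (Z0 *m u).
have line t : 0 < qf P u - qf P (r + t *: u).
  (* The factor [t / sqn u] is chosen so that [J K *m (Z *m u) = r + t *: u]. *)
  pose Z := Z0 + (t / sqn u) *: (c *m u^T).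
  have ZE : col_mx (usubmx Z)^T^T (dsubmx Z)^T^T = Z by rewrite !trmxK vsubmxK.
  have SZ : Sig (usubmx Z)^T (dsubmx Z)^T.
    apply/(SigmaP _ _ _ _ sPhi11 sPhi22) => v; rewrite ZE.
    have DZ : D^T *m (Z *m v) = D^T *m (Z0 *m v).
      rewrite mulmxDl mulmxDr -scalemxAl -scalemxAr !mulmxA Dc.
      by rewrite !mul0mx scaler0 addr0.
    by have := N0 v; rewrite !qf_Nmat DZ.
  have := robust_gt0 SZ u0; rewrite ZE mulmxDl mulmxDr -/r -scalemxAl -scalemxAr.
  rewrite -mulmxA [u^T *m u]mx11_scalar mul_mx_scalar -scalemxAr scalerA.
  have -> : (u^T *m u) 0 0 = sqn u by rewrite /sqn /qf /bil mulmx1.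
  by rewrite divfK // gt_eqF.
(* Adding the two inequalities leaves [- 2 * qf P r > 0]. *)
have := line 1; have := line (-1); have := posdef_qf_ge0 r P_pos.
rewrite !qfD !qfZ !bilZl !bilZr; lra.
Qed.

Hypothesis slater : exists Zbar : 'M[R]_(n + m, n),
  posdef ((col_mx 1%:M Zbar)^T *m N *m col_mx 1%:M Zbar).
Hypothesis feasible : exists A B, Sig A B.

(** In the variable [x] strict positivity fails at [(0, x)] with [x] a nonzero kernel vector of
    [D^T], so compactness is applied in the variables [v] and [y = D^T *m x]. *)
Lemma robust_coercive : exists2 beta, 0 < beta &
  forall v x, 0 <= qf N (col_mx v x) ->
    beta * sqn v <= qf P v - qf P (J K *m x : 'cV_n).
Proof.
have /submxP[G JG] : (J K <= D^T)%MS by apply: submx_of_ker => c; exact: robust_ker.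
pose C := cokermx D.
(* [F] is [N] in the variables [(v, y)], [H] is nonnegative exactly when [y] lies in the range of
   [D^T], and [M] is the Lyapunov form through [J K = G *m D^T]. *)
pose B : 'M_(n + T) := block_mx 1%:M 0 Xp^T (- 1%:M).
pose F := B^T *m Phi *m B.
pose H : 'M_(n + T) := block_mx 0 0 0 (- (C *m C^T)).
pose M : 'M_(n + T) := block_mx P 0 0 (- (G^T *m P *m G)).
have qF v y : qf F (col_mx v y) = qf Phi (col_mx v (Xp^T *m v - y)).
  by rewrite -qf_mul mul_block_col mul1mx mul0mx addr0 mulNmx mul1mx.
have qH v y : qf H (col_mx v y) = - sqn (C^T *m y).
  by rewrite /qf bil_block !bil_mx0 !add0r bil_mxN /sqn qf_mul trmxK mulmx1.
have qM v y : qf M (col_mx v y) = qf P v - qf P (G *m y).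
  by rewrite /qf bil_block !bil_mx0 !addr0 bil_mxN bil_mul.
have [w|beta beta0 coer] := posform_coercive (F := F) (H := H) (G := M).
  rewrite -[w]vsubmxK; move: (usubmx w) (dsubmx w) => v y vy0.
  rewrite qF qH qM oppr_ge0 => Fvy Cy.
  have /submxP[z yz] : (y^T <= D)%MS.
    have : C^T *m y == 0 by rewrite -sqn_eq0 eq_le Cy sqn_ge0.
    by rewrite submxE -/C -{1}[y]trmxK -trmx_mul trmx_eq0.
  have {}yz : y = D^T *m z^T by rewrite -trmx_mul -yz trmxK.
  move: Fvy; rewrite yz [G *m _]mulmxA -JG -qf_Nmat => Nvz.
  (* For [v != 0] the point lifts to a system in [Sigma]. For [v = 0] the constraint reads
     [0 <= qf Phi22 y] with [y != 0], which is impossible. *)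
  have [v0|v0] := eqVneq v 0; last first.
    have [A [B' [SAB <-]]] := Sigma_lift sPhi11 sPhi22 Phi22_neg slater v0 Nvz.
    exact: robust_gt0.
  have y0 : y != 0 by apply: contraNneq vy0 => ->; rewrite v0 col_mx0.
  move: Nvz; rewrite qf_Nmat -yz v0 mulmx0 sub0r qf_Phi /qf !bil0l mulr0 !add0r.
  by rewrite bilNl bilNr opprK -/(qf _ _) leNgt negdef_qf_lt0.
exists beta => // v x Nvx.
have := coer (col_mx v (D^T *m x)); rewrite qF qH qM [G *m _]mulmxA -JG -qf_Nmat.
have -> : C^T *m (D^T *m x) = 0 by rewrite mulmxA -trmx_mul mulmx_coker trmx0 mul0mx.
have -> : sqn (col_mx v (D^T *m x)) = sqn v + sqn (D^T *m x).
  by rewrite /sqn /qf scalar_mx_block bil_block !bil_mx0 !addr0.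
have -> : sqn (0 : 'cV[R]_T) = 0 by rewrite /sqn /qf bil0l.
rewrite oppr0 => /(_ Nvx (lexx _)); apply: le_trans.
by rewrite ler_pM2l // lerDl sqn_ge0.
Qed.

Lemma robust_LMI : exists alpha beta,
  [/\ 0 <= alpha, 0 < beta & possemidef (LMI P (K *m P) alpha beta)].
Proof.
have [beta beta0 coer] := robust_coercive.
pose M := block_mx (P - beta%:M) 0 0 (- ((J K)^T *m P *m J K)).
have qM v x : qf M (col_mx v x) = qf P v - beta * sqn v - qf P (J K *m x : 'cV_n).
  rewrite /qf bil_block !bil_mx0 !addr0 bil_mxD !bil_mxN -(scalemx1 _ beta) bil_mxZ.
  by rewrite [in RHS]bil_mul.
have [alpha alpha0 Malpha] :
    exists2 alpha, 0 <= alpha & forall w, alpha * qf N w <= qf M w.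
  (* The S-lemma needs a point where [N] is positive, hence a nonzero [v]. If there is none, then
     [n = 0], [M] vanishes as a form and [alpha = 0] works. *)
  have [[v0 v00]|/forallNP v0] := pselect (exists v : 'cV[R]_n, v != 0).
    apply: s_lemma => [|w].
      by have [x] := slater_vec slater v00; exists (col_mx v0 x).
    by rewrite -[w]vsubmxK => /coer; rewrite qM; lra.
  exists 0 => // w; rewrite -[w]vsubmxK qM mul0r.
  have z0 (v : 'cV[R]_n) : v = 0 by apply/eqP/negPn/negP/v0.
  by rewrite [usubmx w]z0 [J K *m _]z0 /sqn /qf !bil0l mulr0 !subr0.
exists alpha, beta; split=> //; split; first by apply: symmx_LMI => //; case: P_pos.
move=> w; rewrite -/(bil _ _ _) -/(qf _ _) -[w]vsubmxK -[usubmx w]vsubmxK.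
rewrite qf_LMI; last by case: P_pos.
rewrite -qM; have := Malpha (col_mx (usubmx (usubmx w)) (dsubmx (usubmx w))).
have := posdef_qf_ge0 (dsubmx w + K^T *m dsubmx (dsubmx (usubmx w))) P_pos.
lra.
Qed.

End Robust.
End Feedback.

End QuadraticMatrixInequalities.

Theorem theorem7 (R : realType) (n m T : nat)
  (As : 'M[R]_n) (Bs : 'M[R]_(n, m))
  (Xp Xm : 'M[R]_(n, T)) (Um : 'M[R]_(m, T)) (Wm : 'M[R]_(n, T))
  (Phi11 : 'M[R]_n) (Phi12 : 'M[R]_(n, T)) (Phi22 : 'M[R]_T) :
  symmx Phi11 -> symmx Phi22 -> negdef Phi22 ->
  Xp = As *m Xm + Bs *m Um + Wm ->
  noise_ok Phi11 Phi12 Phi22 Wm ->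
  (exists Zbar : 'M[R]_(n + m, n),
     posdef ((col_mx 1%:M Zbar)^T *m Nmat Xp Xm Um Phi11 Phi12 Phi22 *m col_mx 1%:M Zbar)) ->
  (informative_qs Xp Xm Um Phi11 Phi12 Phi22 <->
     exists (P : 'M[R]_n) (L : 'M[R]_(m, n)) (alpha beta : R),
       [/\ posdef P, 0 <= alpha, 0 < beta &
           possemidef (LMI_left P L beta - alpha *: LMI_right Xp Xm Um Phi11 Phi12 Phi22)])
  /\
  (forall (P : 'M[R]_n) (L : 'M[R]_(m, n)) (alpha beta : R),
     posdef P -> 0 <= alpha -> 0 < beta ->
     possemidef (LMI_left P L beta - alpha *: LMI_right Xp Xm Um Phi11 Phi12 Phi22) ->
     let K := L *m invmx P in
     (forall A B, Sigma Xp Xm Um Phi11 Phi12 Phi22 A B ->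
        posdef (P - (A + B *m K) *m P *m (A + B *m K)^T)) /\
     (forall A B, Sigma Xp Xm Um Phi11 Phi12 Phi22 A B ->
        schur_stable (A + B *m K))).
Proof.
move=> sPhi11 sPhi22 Phi22_neg eqX noise slater.
(* The true system lies in [Sigma], which is the starting point for moving along the kernel. *)
have feasible : exists A B, Sigma Xp Xm Um Phi11 Phi12 Phi22 A B.
  by exists As, Bs, Wm.
split; last first.
  move=> P L alpha beta Ppos alpha0 beta0 lmi K.
  have robust A B : Sigma Xp Xm Um Phi11 Phi12 Phi22 A B ->
      posdef (P - (A + B *m K) *m P *m (A + B *m K)^T).
    exact: (LMI_robust sPhi11 sPhi22 Ppos alpha0 beta0 lmi).
  by split=> // A B /robust; exact: stein_schur_stable.
split=> [[K [P [Ppos robust]]]|[P [L [alpha [beta [Ppos alpha0 beta0 lmi]]]]]].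
  have [alpha [beta [alpha0 beta0 lmi]]] :=
    robust_LMI sPhi11 sPhi22 Phi22_neg Ppos robust slater feasible.
  by exists P, (K *m P), alpha, beta.
exists (L *m invmx P), P; split=> // A B.
exact: (LMI_robust sPhi11 sPhi22 Ppos alpha0 beta0 lmi).
Qed.
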